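(* Let $G$ be a distinguished group, let $A$ be a simple subgroup of $G$ of order $v$, and let $p,q\in G$. Then the set $H_{pq}=(A.p).(A.q)$ has either $v$ or $v^2$ elements.
   Context: A distributive group is a nonempty set $G$ with a binary operation $(a,b)\mapsto a.b$ on $G$ such that for all $a,b\in G$ each of the equations $a.x=b$ and $y.a=b$ has exactly one solution in $G$, and for all $a,b,c\in G$, $(a.b).c=(a.c).(b.c)$ and $c.(a.b)=(c.a).(c.b)$. A subgroup of $G$ is a nonempty subset which is itself a distributive group under the restricted operation; the order is the number of elements. A distributive group is simple if it has no proper subgroup of order greater than one. For subsets $X,Y\subseteq G$ and $p\in G$: $X.Y=\{x.y: x\in X,\,y\in Y\}$, $X.p=\{x.p: x\in X\}$, $p.X=\{p.x:x\in X\}$. A finite distributive group $G$ is called distinguished if for every subgroup $B$ of $G$ and every $p\in G$, the sets $B.(B.p)$ and $(B.p).B$ are subgroups of the same order as $B$; equivalently there are $t,\tau\in G$ with $B.(B.p)=B.t$ and $(B.p).B=B.(p.B)=B.\tau$. *)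

(* Defs.v *)
From mathcomp Require Import all_boot.
Set Implicit Arguments.
Unset Strict Implicit.
Unset Printing Implicit Defensive.

Section DistributiveGroups.

Variables (G : finType) (op : G -> G -> G).

(* [X] is a distributive group under the restriction of [op]; the whole type
   is one when [distributive_group [set: G]].  As [op] is total on [G], that
   its restriction is an operation on [X] has to be required. *)
Definition distributive_group (X : {set G}) : Prop :=
  [/\ X != set0,
      {in X &, forall a b, op a b \in X},
      {in X &, forall a b, exists! x, x \in X /\ op a x = b},
      {in X &, forall a b, exists! y, y \in X /\ op y a = b} &
      {in X & &, forall a b c,
         op (op a b) c = op (op a c) (op b c)
         /\ op c (op a b) = op (op c a) (op c b)}].

Definition subgroup_of (X B : {set G}) : Prop :=
  B \subset X /\ distributive_group B.

Definition simple_group (X : {set G}) : Prop :=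
  distributive_group X /\
  ~ (exists B : {set G}, [/\ subgroup_of X B, B != X & 1 < #|B|]).

Definition prodset (X Y : {set G}) : {set G} := [set op x y | x in X, y in Y].

Definition rtrans (X : {set G}) (p : G) : {set G} := [set op x p | x in X].

Definition distinguished : Prop :=
  distributive_group [set: G] /\
  forall (B : {set G}) (p : G), subgroup_of [set: G] B ->
    [/\ subgroup_of [set: G] (prodset B (rtrans B p)),
        #|prodset B (rtrans B p)| = #|B|,
        subgroup_of [set: G] (prodset (rtrans B p) B) &
        #|prodset (rtrans B p) B| = #|B|].

End DistributiveGroups.

(* Main.v *)
Require Import Defs.
From mathcomp Require Import all_boot.

(** Write [B.s] for [rtrans op B s].  For a subgroup [B] of a distinguished
    group, any two sets [B.s] are equal or disjoint.  Indeed each [b.(B.s)] with [b]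
    in [B] lies in [B.(B.s)], which has only [#|B|] elements, so
    [b.(B.s) = B.(B.s)] for every such [b]; on the other hand left
    distributivity gives [b.(B.s) = (b.B).(b.s) = B.(b.s)].  Hence a common
    element [a.s = b.t] of [B.s] and [B.t] yields
    [a.(B.s) = B.(a.s) = B.(b.t) = b.(B.t) = a.(B.t)], and [B.s = B.t] by
    cancellation ([rtrans_eq_of_meet]).

    Now [B = A.p] is itself a subgroup of order [v], and [(A.p).(A.q)] is the
    union of the sets [B.(a.q)], [a] in [A].  By the above it has [v * k]
    elements, [k] being the number of different sets among them.  The [x] in
    [A] giving the same set as a fixed [a] are closed under the operation, so
    they form a subgroup of [A] ([closed_distributive_group]).  Simplicity of
    [A] makes this subgroup a single element for every [a], whence [k = v], or
    all of [A] for some [a], whence [k = 1]. *)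

Set Implicit Arguments.
Unset Strict Implicit.
Unset Printing Implicit Defensive.

Section Translates.

Variables (G : finType) (op : G -> G -> G).
Hypothesis hG : distributive_group op [set: G].

Lemma op_injl a : injective (op a).
Proof.
case: hG => _ _ divl _ _ x y exy.
have [z [_ uz]] := divl a (op a x) (in_setT _) (in_setT _).
by rewrite -(uz x) ?in_setT // -(uz y) ?in_setT.
Qed.

Lemma op_injr a : injective (op^~ a).
Proof.
case: hG => _ _ _ divr _ x y exy.
have [z [_ uz]] := divr a (op x a) (in_setT _) (in_setT _).
by rewrite -(uz x) ?in_setT // -(uz y) ?in_setT.
Qed.

Lemma opDr a b c : op (op a b) c = op (op a c) (op b c).
Proof. by case: hG => _ _ _ _ /(_ a b c) []; rewrite ?in_setT. Qed.

Lemma opDl a b c : op c (op a b) = op (op c a) (op c b).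
Proof. by case: hG => _ _ _ _ /(_ a b c) []; rewrite ?in_setT. Qed.

(** An injection of a finite set into itself is onto, so each translation by
    an element of [X] permutes [X]. *)
Lemma closed_inj_imset (f : G -> G) (X : {set G}) :
  injective f -> {in X, forall x, f x \in X} -> f @: X = X.
Proof.
move=> fI fX; apply/eqP; rewrite eqEcard card_imset // leqnn andbT.
by apply/subsetP=> _ /imsetP [x xX ->]; exact: fX.
Qed.

Lemma closed_distributive_group (X : {set G}) :
  X != set0 -> {in X &, forall a b, op a b \in X} -> distributive_group op X.
Proof.
move=> X0 Xop; split=> // [a b aX bX|a b aX bX|a b c _ _ _]; last first.
- by split; [exact: opDr | exact: opDl].
- have: b \in op^~ a @: X.
    by rewrite closed_inj_imset //; [exact: op_injr | move=> x xX; exact: Xop].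
  case/imsetP=> y yX ->; exists y; split=> // z [_].
  by move/(@op_injr a).
- have: b \in op a @: X.
    by rewrite closed_inj_imset //; [exact: op_injl | move=> x xX; exact: Xop].
  case/imsetP=> y yX ->; exists y; split=> // z [_].
  by move/(@op_injl a).
Qed.

Lemma card_rtrans (B : {set G}) s : #|rtrans op B s| = #|B|.
Proof. by rewrite card_imset //; exact: op_injr. Qed.

Lemma rtrans_closed (B : {set G}) s :
  distributive_group op B ->
  {in rtrans op B s &, forall x y, op x y \in rtrans op B s}.
Proof.
case=> _ Bop _ _ _ _ _ /imsetP [a aB ->] /imsetP [b bB ->].
by rewrite -opDr; apply: imset_f; exact: Bop.
Qed.

Lemma rtrans_subgroup (B : {set G}) s :
  distributive_group op B -> distributive_group op (rtrans op B s).
Proof.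
move=> gB; apply: closed_distributive_group; last exact: rtrans_closed.
by rewrite -card_gt0 card_rtrans card_gt0; case: gB.
Qed.

(** Since [b.(x.y) = (b.x).(b.y)] with both factors in [B.s], which is closed,
    [B.(x.y)] is contained in [B.s]; both have [#|B|] elements. *)
Lemma rtrans_eq_op (B : {set G}) s x y : distributive_group op B ->
  rtrans op B x = rtrans op B s -> rtrans op B y = rtrans op B s ->
  rtrans op B (op x y) = rtrans op B s.
Proof.
move=> gB ex ey; apply/eqP; rewrite eqEcard !card_rtrans leqnn andbT.
apply/subsetP=> _ /imsetP [b bB ->]; rewrite opDl.
by apply: rtrans_closed => //; [rewrite -ex | rewrite -ey]; exact: imset_f.
Qed.

(** [b.(B.s) = (b.B).(b.s)], and [b.B] is contained in [B]. *)
Lemma imset_rtrans (B : {set G}) b s : distributive_group op B -> b \in B ->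
  op b @: rtrans op B s = rtrans op B (op b s).
Proof.
case=> _ Bop _ _ _ bB; apply/eqP.
rewrite eqEcard card_imset ?card_rtrans ?leqnn ?andbT; last exact: op_injl.
apply/subsetP=> _ /imsetP [_ /imsetP [c cB ->] ->].
by rewrite opDl; apply: imset_f; exact: Bop.
Qed.

(** The only use of the cardinality condition: it makes [b.(B.r)] the same
    set for all [b] in [B], which lets an equality of representatives
    [a.s = b.t] be turned into an equality of sets. *)
Lemma rtrans_eq_of_meet (B : {set G}) s t x : distributive_group op B ->
  (forall r, #|prodset op B (rtrans op B r)| = #|B|) ->
  x \in rtrans op B s -> x \in rtrans op B t -> rtrans op B s = rtrans op B t.
Proof.
move=> gB cardBB /imsetP [a aB ->] /imsetP [b bB e].
have full c r : c \in B -> op c @: rtrans op B r = prodset op B (rtrans op B r).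
  move=> cB; apply/eqP; rewrite eqEcard cardBB card_imset ?card_rtrans ?leqnn.
    rewrite andbT; apply/subsetP=> _ /imsetP [y yBr ->].
    by apply/imset2P; exists c y.
  exact: op_injl.
apply: (imset_inj (@op_injl a)).
by rewrite imset_rtrans // e -imset_rtrans // !full.
Qed.

End Translates.

(** Each nonempty fibre of [f] on [A] is closed under the operation, hence a
    subgroup of [A]; a fibre with two elements must therefore be all of [A]. *)
Lemma simple_fibres (G : finType) (op : G -> G -> G) (T : eqType) (f : G -> T)
    (A : {set G}) :
  distributive_group op [set: G] -> simple_group op A ->
  (forall a x y, f x = f a -> f y = f a -> f (op x y) = f a) ->
  {in A &, injective f} \/ exists c, {in A, forall x, f x = c}.
Proof.
move=> gG [[_ Aop _ _ _] simA] fop.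
case: (boolP [forall x in A, forall y in A, (f x == f y) ==> (x == y)]).
  move=> inj; left=> x y xA yA exy; apply/eqP.
  by move/forall_inP/(_ x xA)/forall_inP/(_ y yA)/implyP: inj; apply; apply/eqP.
case/forall_inPn=> a aA /forall_inPn [b bA]; rewrite negb_imply.
case/andP=> /eqP eab neq_ab; right; exists (f a).
set D := [set x in A | f x == f a].
have aD : a \in D by rewrite inE aA eqxx.
have bD : b \in D by rewrite inE bA eab eqxx.
suff DA : D = A by move=> x; rewrite -DA inE => /andP [_ /eqP].
apply/eqP/negPn/negP=> neqDA; case: simA; exists D; split=> //; last first.
  by apply/card_gt1P; exists a, b.
split; first by apply/subsetP=> x; rewrite inE => /andP [].
apply: closed_distributive_group => //; first by apply/set0Pn; exists a.
move=> x y; rewrite !inE => /andP [xA /eqP fx] /andP [yA /eqP fy].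
by rewrite Aop //= (fop a) ?eqxx.
Qed.

Theorem theorem5p5 (G : finType) (op : G -> G -> G)
  (hG : distinguished op)
  (A : {set G}) (v : nat)
  (hA : subgroup_of op [set: G] A)
  (hsimple : simple_group op A)
  (hv : #|A| = v)
  (p q : G) :
  #|prodset op (rtrans op A p) (rtrans op A q)| = v \/
  #|prodset op (rtrans op A p) (rtrans op A q)| = v ^ 2.
Proof.
case: hG => gG dist; case: hA => _ gA.
set B := rtrans op A p.
have gB : distributive_group op B by exact: rtrans_subgroup.
have cardB : #|B| = v by rewrite card_rtrans.
have cardBB r : #|prodset op B (rtrans op B r)| = #|B|.
  by case: (dist B r) => //; split=> //; exact: subsetT.
set H := prodset _ _ _.
pose f a := rtrans op B (op a q).
have partP : partition (f @: A) H.
  apply/and3P; split.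
  - rewrite cover_imset; apply/eqP/setP=> x; apply/bigcupP/imset2P.
      case=> a aA /imsetP [b bB ->].
      by exists b (op a q) => //; exact: imset_f.
    case=> b _ bB /imsetP [a aA ->] ->.
    by exists a => //; exact: imset_f.
  - apply/trivIsetP=> _ _ /imsetP [a aA ->] /imsetP [b bA ->]; apply: contraR.
    case/pred0Pn=> x /andP [xa xb]; apply/eqP.
    exact: rtrans_eq_of_meet xa xb.
  - apply/imsetP=> -[a aA] /esym/eqP; rewrite -cards_eq0 card_rtrans //.
    by rewrite cards_eq0; apply/negP; case: gB.
have -> : #|H| = #|f @: A| * v.
  apply: card_uniform_partition partP => _ /imsetP [a aA ->].
  by rewrite card_rtrans.
have fop a x y : f x = f a -> f y = f a -> f (op x y) = f a.
  by rewrite /f opDr //; exact: rtrans_eq_op.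
have [fI|[c fc]] := simple_fibres gG hsimple fop.
  by right; rewrite card_in_imset // hv mulnn.
left; have [x xA] : exists x, x \in A by apply/set0Pn; case: gA.
suff -> : f @: A = [set c] by rewrite cards1 mul1n.
apply/setP=> Y; rewrite inE; apply/imsetP/eqP=> [[a aA ->]|->].
  exact: fc.
by exists x; rewrite ?fc.
Qed.
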